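(* Let $C(q)=\sum_{j\ge 0}C_j q^j$ be a formal power series with $C(0)=1$, and let $(s_{n,k})_{n\ge 1,\,1\le k\le n}$ be complex numbers such that, for every sequence $\{a_n\}_{n\ge 1}$ of complex numbers, \[ \sum_{n\ge 1}\frac{a_n q^n}{1-q^n}=\frac{1}{C(q)}\sum_{n\ge 1}\Big(\sum_{k=1}^n s_{n,k}a_k\Big)q^n \] as formal power series in $q$. Set $s_{n,k}:=0$ for $k>n$. Then for all integers $n,k\ge 1$, \[ \text{(i)}\quad s_{n,k}=\sum_{i=1}^{\lfloor n/k\rfloor}[q^{n-ik}]\,C(q), \qquad\text{(ii)}\quad s_{n,k}=[q^n]\,\frac{q^k}{1-q^k}\,C(q). \]
   Context: $[q^m]F(q)$ denotes the coefficient of $q^m$ in the formal power series $F(q)$. *)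

(* Defs.v *)
From HB Require Import structures.
From mathcomp Require Import all_boot all_order all_algebra.
From mathcomp Require Import boolp classical_sets fsbigop reals.
From mathcomp Require Import complex.

Set Implicit Arguments.
Unset Strict Implicit.
Unset Printing Implicit Defensive.

Import GRing.Theory.
Local Open Scope ring_scope.

Record fps (K : Type) := Fps { fps_coef : nat -> K }.

Notation "[ 'q^' m ] F" := (fps_coef F m)
  (at level 0, F at level 0, format "[ 'q^' m ]  F") : ring_scope.

HB.instance Definition _ (K : Type) := gen_eqMixin (fps K).
HB.instance Definition _ (K : Type) := gen_choiceMixin (fps K).

Lemma fpsP (K : Type) (F G : fps K) :
  (forall m, fps_coef F m = fps_coef G m) <-> F = G.
Proof.
split=> [|-> //]; case: F G => f [g] /= fg; congr Fps.
by apply/funext => m; apply: fg.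
Qed.

Section Zmodule.
Variable K : zmodType.
Implicit Types F G H : fps K.

Definition fps_zero : fps K := Fps (fun=> 0).
Definition fps_opp F := Fps (fun m => - fps_coef F m).
Definition fps_add F G := Fps (fun m => fps_coef F m + fps_coef G m).

Fact fps_addA : associative fps_add.
Proof. by move=> F G H; apply/fpsP => m /=; rewrite addrA. Qed.
Fact fps_addC : commutative fps_add.
Proof. by move=> F G; apply/fpsP => m /=; rewrite addrC. Qed.
Fact fps_add0 : left_id fps_zero fps_add.
Proof. by move=> F; apply/fpsP => m /=; rewrite add0r. Qed.
Fact fps_addN : left_inverse fps_zero fps_opp fps_add.
Proof. by move=> F; apply/fpsP => m /=; rewrite addNr. Qed.

HB.instance Definition _ :=
  GRing.isZmodule.Build (fps K) fps_addA fps_addC fps_add0 fps_addN.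

Lemma fps_coef0 m : fps_coef (0 : fps K) m = 0. Proof. by []. Qed.
Lemma fps_coefD F G m : fps_coef (F + G) m = fps_coef F m + fps_coef G m.
Proof. by []. Qed.
Lemma fps_coefN F m : fps_coef (- F) m = - fps_coef F m.
Proof. by []. Qed.
Lemma fps_coefB F G m : fps_coef (F - G) m = fps_coef F m - fps_coef G m.
Proof. by []. Qed.
End Zmodule.

Section Ring.
Variable K : comNzRingType.
Implicit Types (F G H : fps K) (c : K).

Definition fpsC c : fps K := Fps (fun m => if m == 0%N then c else 0).
Definition fps_mul F G : fps K :=
  Fps (fun m => \sum_(j < m.+1) fps_coef F j * fps_coef G (m - j)).

Let trunc m F : {poly K} := \poly_(i < m.+1) fps_coef F i.

Let coef_truncM (P Q : {poly K}) m F G :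
  (forall i, (i <= m)%N -> P`_i = fps_coef F i) ->
  (forall i, (i <= m)%N -> Q`_i = fps_coef G i) ->
  forall i, (i <= m)%N -> (P * Q)`_i = fps_coef (fps_mul F G) i.
Proof.
move=> PF QG i im; rewrite coefM /=; apply: eq_bigr => j _.
by rewrite PF ?QG // ?(leq_trans (leq_subr _ _)) // (leq_trans _ im) // -ltnS.
Qed.

Let coef_trunc m F i : (i <= m)%N -> (trunc m F)`_i = fps_coef F i.
Proof. by move=> im; rewrite coef_poly ltnS im. Qed.

Fact fps_mulA : associative fps_mul.
Proof.
move=> F G H; apply/fpsP => m; set t := trunc m.
transitivity ((t F * (t G * t H))`_m); last rewrite mulrA.
  symmetry; apply: (coef_truncM (coef_trunc _)) (leqnn m).
  exact: coef_truncM (coef_trunc _) (coef_trunc _).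
apply: (coef_truncM _ (coef_trunc _)) (leqnn m).
exact: coef_truncM (coef_trunc _) (coef_trunc _).
Qed.

Fact fps_mulC : commutative fps_mul.
Proof.
move=> F G; apply/fpsP => m; set t := trunc m.
transitivity ((t F * t G)`_m); last rewrite mulrC.
  by symmetry; apply: (coef_truncM (coef_trunc _) (coef_trunc _)) (leqnn m).
exact: (coef_truncM (coef_trunc _) (coef_trunc _)) (leqnn m).
Qed.

Fact fps_mul1 : left_id (fpsC 1) fps_mul.
Proof.
move=> F; apply/fpsP => m /=; rewrite big_ord_recl /= subn0 mul1r.
by rewrite big1 ?addr0 // => i _; rewrite mul0r.
Qed.

Fact fps_mulDl : left_distributive fps_mul +%R.
Proof.
move=> F G H; apply/fpsP => m /=; rewrite -big_split /=.
by apply: eq_bigr => i _; rewrite mulrDl.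
Qed.

Fact fps_one_neq0 : fpsC 1 != 0.
Proof. by apply/eqP => /fpsP/(_ 0%N)/eqP; rewrite /= oner_eq0. Qed.

HB.instance Definition _ := GRing.Zmodule_isComNzRing.Build (fps K)
  fps_mulA fps_mulC fps_mul1 fps_mulDl fps_one_neq0.

Lemma fps_coef1 m : fps_coef (1 : fps K) m = (m == 0%N)%:R.
Proof. by rewrite /= ; case: eqP. Qed.
Lemma fps_coefM F G m :
  fps_coef (F * G) m = \sum_(j < m.+1) fps_coef F j * fps_coef G (m - j).
Proof. by []. Qed.
Lemma fps_coefCM c F m : fps_coef (fpsC c * F) m = c * fps_coef F m.
Proof.
rewrite fps_coefM big_ord_recl /= subn0 big1 ?addr0 // => i _.
by rewrite mul0r.
Qed.

Lemma fps_coefX_small F n m :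
  fps_coef F 0%N = 0 -> (m < n)%N -> fps_coef (F ^+ n) m = 0.
Proof.
move=> F0; elim: n m => // n IHn m mn.
rewrite exprS fps_coefM big_ord_recl F0 mul0r add0r big1 // => i _.
rewrite IHn ?mulr0 //= /bump /=; have := ltn_ord i.
by case: m mn i => [|m] mn i im; [case: i im | rewrite subSS (leq_ltn_trans (leq_subr _ _))].
Qed.

Definition fpsX : fps K := Fps (fun m => if m == 1%N then 1 else 0).
End Ring.

Notation "''q'" := (fpsX _) (at level 0) : ring_scope.

Section UnitRing.
Variable K : comUnitRingType.
Implicit Types F G : fps K.

Definition fps_unit : {pred fps K} :=
  fun F => fps_coef F 0%N \is a GRing.unit.

(* F^-1 = c^-1 * \sum_k (1 - c^-1 F)^k with c = F(0); the k-th power has no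
   terms of degree < k. *)
Definition fps_inv F : fps K :=
  let c := (fps_coef F 0%N)^-1 in
  if F \in fps_unit then
    Fps (fun m => c * fps_coef (\sum_(k < m.+1) (1 - fpsC c * F) ^+ k) m)
  else F.

Fact fps_mulVx : {in fps_unit, left_inverse 1 fps_inv *%R}.
Proof.
move=> F uF; rewrite /fps_inv uF /=; set c := _^-1; set u := 1 - _.
have u0 : fps_coef u 0%N = 0.
  by rewrite /u fps_coefB fps_coefCM /= /c mulVr ?subrr.
have stab N m : (m <= N)%N ->
    fps_coef (\sum_(k < m.+1) u ^+ k) m = fps_coef (\sum_(k < N.+1) u ^+ k) m.
  elim: N => [|N IHN]; first by rewrite leqn0 => /eqP ->.
  rewrite leq_eqVlt => /predU1P[-> //|]; rewrite ltnS => mN.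
  by rewrite [in RHS]big_ord_recr fps_coefD /= (fps_coefX_small u0) ?addr0 ?IHN.
apply/fpsP => m; set S := \sum_(k < m.+1) u ^+ k.
have -> : fps_coef (1 : fps K) m = fps_coef (fpsC c * S * F) m.
  rewrite mulrAC mulrC; have -> : fpsC c * F = 1 - u by rewrite /u subKr.
  have -> : S * (1 - u) = 1 - u ^+ m.+1.
    by apply: oppr_inj; rewrite -mulrN !opprB subrX1 mulrC.
  by rewrite fps_coefB (fps_coefX_small u0) // subr0.
rewrite [LHS]fps_coefM [RHS]fps_coefM; apply: eq_bigr => j _.
by rewrite fps_coefCM /= (stab m) // -ltnS.
Qed.

Fact fps_unitPl F G : G * F = 1 -> fps_unit F.
Proof.
move=> /fpsP/(_ 0%N); rewrite fps_coefM big_ord1 /= => GF1.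
by apply/unitrPr; exists (fps_coef G 0%N); rewrite mulrC.
Qed.

Fact fps_inv_out : {in [predC fps_unit], fps_inv =1 id}.
Proof. by move=> F; rewrite inE /fps_inv => /negbTE ->. Qed.

HB.instance Definition _ := GRing.ComNzRing_hasMulInverse.Build (fps K)
  fps_mulVx fps_unitPl fps_inv_out.
End UnitRing.

(* Sum of a locally finite family of series: for each m, only finitely many of
   the F n with n \in A have a nonzero coefficient of q^m (otherwise that
   coefficient of the sum is 0 by convention). *)
Definition fps_sum (K : zmodType) (A : set nat) (F : nat -> fps K) : fps K :=
  Fps (fun m => \sum_(n \in A) fps_coef (F n) m).

(* The default value 0 is never used when the n-th series has order at least n. *)
Lemma fps_coef_sum (K : zmodType) (F : nat -> fps K) (N m : nat) :
  (forall n, (N <= n)%N -> fps_coef (F n) m = 0) ->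
  fps_coef (fps_sum [set n | (1 <= n)%N]%classic F) m =
  \sum_(1 <= n < N) fps_coef (F n) m.
Proof.
move=> F0.
rewrite /= -(fsbig_widen [set` index_iota 1 N]%classic).
- by rewrite -fsbig_seq ?iota_uniq.
- by move=> n /=; rewrite mem_index_iota => /andP[].
- move=> n [/= n1]; rewrite mem_index_iota n1 /= => /negP.
  by rewrite -leqNgt => /F0.
Qed.

(* Main.v *)
Require Import Defs.
From mathcomp Require Import all_boot all_order all_algebra.
From mathcomp Require Import boolp classical_sets fsbigop reals.
From mathcomp Require Import complex.

Set Implicit Arguments.
Unset Strict Implicit.
Unset Printing Implicit Defensive.

Import GRing.Theory.
Local Open Scope classical_set_scope.
Local Open Scope ring_scope.

(** Take for [a] the indicator sequence of [k]: the left-hand side collapses to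
    [G = q^k / (1 - q^k)] and the [n]-th coefficient of the last factor on the
    right becomes [s_{n,k}], which is (ii). Then (i) follows by iterating
    [G C = q^k C + q^k (G C)]. *)

Lemma fps_coefX (K : comNzRingType) m : [q^m] ('q : fps K) = (m == 1%N)%:R.
Proof. by rewrite /=; case: eqP. Qed.

Lemma fps_coefXnM (K : comNzRingType) (F : fps K) n m :
  [q^m] ('q ^+ n * F) = if (m < n)%N then 0 else [q^(m - n)] F.
Proof.
elim: n m => [|n IHn] m; first by rewrite expr0 mul1r /= subn0.
rewrite exprS -mulrA fps_coefM big_ord_recl fps_coefX mul0r add0r.
case: m => [|m]; first by rewrite big_ord0.
(* Of the convolution with ['q] only index 1 survives, a shift by one degree. *)
rewrite big_ord_recl big1 => [|i _]; last by rewrite fps_coefX mul0r.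
by rewrite fps_coefX mul1r addr0 IHn lift0 subn1.
Qed.

Lemma fps_coefXn (K : comNzRingType) n m :
  [q^m] ('q ^+ n : fps K) = (m == n)%:R.
Proof.
rewrite -[_ ^+ n]mulr1 fps_coefXnM.
case: ltnP => [mn|nm]; first by rewrite ltn_eqF.
by rewrite fps_coef1 subn_eq0 eqn_leq nm andbT.
Qed.

Lemma fpsC0 (K : comNzRingType) : fpsC 0 = 0 :> fps K.
Proof. by apply/fpsP => m /=; case: ifP. Qed.

Lemma fps_unitE (K : comUnitRingType) (F : fps K) :
  (F \is a GRing.unit) = ([q^0] F \is a GRing.unit).
Proof. by []. Qed.

Lemma fps_sum_delta (K : zmodType) (F : nat -> fps K) k : (0 < k)%N ->
  (forall n, n != k -> F n = 0) -> fps_sum [set n | (1 <= n)%N] F = F k.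
Proof.
move=> k0 F0; apply/fpsP => m.
rewrite (@fps_coef_sum _ _ k.+1) => [|n kn]; last first.
  by rewrite F0 // gtn_eqF.
rewrite big_nat_recr //= big_nat big1 ?add0r // => n /andP[_ nk].
by rewrite F0 // ltn_eqF.
Qed.

Lemma fps_coef_sumCXn (K : comNzRingType) (c : nat -> K) n : (0 < n)%N ->
  [q^n] (fps_sum [set n | (1 <= n)%N] (fun n => fpsC (c n) * 'q ^+ n)) = c n.
Proof.
(* Cutting at [n.+1] is safe: a term of index [m > n] starts in degree [m]. *)
move=> n0; rewrite (@fps_coef_sum _ _ n.+1) => [|m nm]; last first.
  by rewrite fps_coefCM fps_coefXn ltn_eqF // mulr0.
rewrite big_nat_recr // big_nat big1 => [|m /andP[_ mn]].
  by rewrite Monoid.mul1m fps_coefCM fps_coefXn eqxx mulr1.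
by rewrite fps_coefCM fps_coefXn gtn_eqF // mulr0.
Qed.

(** The constant coefficient is 1 once [k > 0]; at [k = 0] the series would be 0. *)
Lemma fps_unit_1BXn (K : comUnitRingType) k : (0 < k)%N ->
  (1 - 'q ^+ k : fps K) \is a GRing.unit.
Proof.
by move=> k0; rewrite fps_unitE fps_coefB fps_coef1 fps_coefXn (ltn_eqF k0)
  mulr0n subr0 unitr1.
Qed.

Lemma fps_coef_lambertM (K : comUnitRingType) (C : fps K) k n : (0 < k)%N ->
  [q^n] ('q ^+ k / (1 - 'q ^+ k) * C) =
  \sum_(1 <= i < (n %/ k).+1) [q^(n - i * k)] C.
Proof.
move=> k0; set G := _ * C.
have GE : G = 'q ^+ k * (C + G).
  have u := fps_unit_1BXn K k0.
  rewrite /G -{2}[C]mul1r -mulrDl mulrA; congr (_ * _ * _).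
  (* Clearing the denominator leaves [1 = (1 - 'q ^+ k) + 'q ^+ k]. *)
  by apply: (mulIr u); rewrite mulrDl mul1r mulVr // mulrVK // subrK.
(* [GE] expresses the coefficient at [n] through the one at [n - k], hence strong induction. *)
elim/ltn_ind: n => n IHn; rewrite GE fps_coefXnM.
case: ltnP => [nk|kn]; first by rewrite divn_small // big_geq.
rewrite fps_coefD IHn; last by rewrite ltn_subrL k0 (leq_trans k0 kn).
(* As [n %/ k = (n - k) %/ k + 1], the term [i = 1] is the contribution of [C], and shifting [i] by
   one in the rest gives the sum for [n - k]. *)
rewrite -[in RHS](subnK kn) divnDr // divnn k0 addn1 [RHS]big_nat_recl //.
rewrite mul1n addnK; congr (_ + _).
by apply: eq_bigr => i _; rewrite mulSn subnDA addnK.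
Qed.

Theorem theorem1 (R : realType) (C : fps R[i]) (s : nat -> nat -> R[i])
    (C0 : [q^0] C = 1)
    (hs : forall a : nat -> R[i],
      fps_sum [set n | (1 <= n)%N] (fun n => fpsC (a n) * 'q ^+ n / (1 - 'q ^+ n)) =
      1 / C * fps_sum [set n | (1 <= n)%N]
                (fun n => fpsC (\sum_(1 <= k < n.+1) s n k * a k) * 'q ^+ n))
    (s0 : forall n k : nat, (1 <= n)%N -> (n < k)%N -> s n k = 0) :
  forall n k : nat, (1 <= n)%N -> (1 <= k)%N ->
    s n k = \sum_(1 <= i < (n %/ k).+1) [q^(n - i * k)] C
    /\ s n k = [q^n] ('q ^+ k / (1 - 'q ^+ k) * C).
Proof.
move=> n k n0 k0; rewrite -fps_coef_lambertM //.
suff -> : s n k = [q^n] ('q ^+ k / (1 - 'q ^+ k) * C) by [].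
have uC : C \is a GRing.unit by rewrite fps_unitE C0 unitr1.
have := hs (fun j => (j == k)%:R).
rewrite (@fps_sum_delta _ _ k) // => [|j /negbTE ->]; last first.
  by rewrite fpsC0 !mul0r.
have -> : fpsC (k == k)%:R = 1 :> fps R[i] by rewrite eqxx.
rewrite mul1r => ->.
(* Multiplying by [C] cancels [1 / C], leaving the inner sum over [j] at index [n]. *)
rewrite div1r mulrC mulrA divrr // mul1r fps_coef_sumCXn //.
(* If [n < k], the index [k] lies outside the sum, which vanishes as [s n k] does by convention;
   otherwise only [j = k] contributes. *)
case: (ltnP n k) => [nk|kn].
  rewrite s0 // big_nat big1 // => j /andP[_ jn].
  by rewrite (ltn_eqF (leq_trans jn nk)) mulr0.
rewrite (big_cat_nat (n := k)) //=; last by rewrite ltnW.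
rewrite big_nat big1 => [|j /andP[_ jk]]; last by rewrite ltn_eqF // mulr0.
rewrite big_ltn ?ltnS // eqxx mulr1 add0r big_nat big1 ?addr0 //.
by move=> j /andP[kj _]; rewrite gtn_eqF // mulr0.
Qed.
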